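(* For any class $\mathcal C$ of CQs, $\mathrm{fghw}(\mathcal C)$ is bounded if, and only if, both $\mathrm{ghw}(\mathcal C)$ and $\mathrm{ghw}(\mathrm{contract}(\mathcal C))$ are bounded.
   Context: An atom is $R(\bar t)$ with $R$ a relation name and $\bar t$ a tuple of variables and constants of length the arity of $R$. A conjunctive query (CQ) $q(X)$ consists of a finite set $q$ of atoms and a set $X\subseteq\mathrm{vars}(q)$ of free variables. Tree decompositions. The underlying hypergraph of $q(X)$ has vertices $\mathrm{vars}(q)$ and hyperedges $\{\mathrm{vars}(\alpha):\alpha\in q\}$. A (generalized hyper-)tree decomposition of a hypergraph $G$ is $(T,\mathbf b,\mathbf a)$ with $T$ a tree, $\mathbf b:V(T)\to2^{V(G)}$, $\mathbf a:V(T)\to2^{E(G)}$ such that (a) every $e\in E(G)$ is contained in some $\mathbf b(v)$; (b) for each $x\in V(G)$, $\{t: x\in\mathbf b(t)\}$ is connected in $T$; (c) $\mathbf b(v)\subseteq\bigcup\mathbf a(v)$ for all $v$. Its width is $\max_v|\mathbf a(v)|$. $\mathrm{ghw}(G)$ is the minimum width of a tree decomposition of $G$, and $\mathrm{ghw}(q(X))$ is that of the underlying hypergraph. A tree decomposition of $q(X)$ is free-connex if there is a connected subtree $T'$ of $T$ (empty if $X=\emptyset$) with $\bigcup_{v\in V(T')}\mathbf b(v)=X$. $\mathrm{fghw}(q(X))$ is the minimum width of a free-connex tree decomposition of $q(X)$. A width measure is bounded on a class if there is a common finite bound for all members of the class. Contraction. A frontier-path in $q(X)$ between distinct variables $x_1$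 and $x_m$ is an alternating sequence $x_1,\alpha_1,x_2,\dots,\alpha_{m-1},x_m$ of variables and atoms of $q$ with $x_i\in\mathrm{vars}(\alpha_i)$ for $1\le i\le m-1$, $x_i\in\mathrm{vars}(\alpha_{i-1})$ for $2\le i\le m$, and $X\cap\{x_1,\dots,x_m\}=\{x_1,x_m\}$. $\mathrm{contract}(q(X))$ is the hypergraph with vertex set $X$ whose hyperedges are (i) each $e\subseteq X$ such that $e=\mathrm{vars}(\alpha)\cap X$ for some atom $\alpha$ of $q$, and (ii) each $\{x,x'\}$ such that $x,x'$ are connected via a frontier-path in $q(X)$. $\mathrm{contract}(\mathcal C)=\{\mathrm{contract}(q(X)):q(X)\in\mathcal C\}$. *)

(* Defs.v *)
From HB Require Import structures.
From mathcomp Require Import all_boot finmap.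
From mathcomp Require Import boolp classical_sets.

Set Implicit Arguments.
Unset Strict Implicit.
Unset Printing Implicit Defensive.

Local Open Scope fset_scope.

Record vocabulary := Vocabulary {
  var : choiceType;
  const : choiceType;
  relname : choiceType;
  arity : relname -> nat }.

Definition term (S : vocabulary) : choiceType := (var S + const S)%type.

Definition atom (S : vocabulary) : choiceType :=
  {R : relname S & (arity R).-tuple (term S)}.

Definition avars (S : vocabulary) (al : atom S) : {fset var S} :=
  [fset x in pmap (fun t : term S => if t is inl x then Some x else None)
                  (tagged al)].

Definition vars (S : vocabulary) (q : {fset atom S}) : {fset var S} :=
  \bigcup_(al <- q) avars al.

Record cq (S : vocabulary) := CQ {
  atoms : {fset atom S};
  free : {fset var S};
  free_vars : free `<=` vars atoms }.

Record hypergraph (V : choiceType) := Hypergraph {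
  hverts : {fset V};
  hedges : {fset {fset V}};
  hedges_sub : forall e, e \in hedges -> e `<=` hverts }.

Definition connected_in (T : finType) (E : rel T) (A : {set T}) : Prop :=
  forall u v, u \in A -> v \in A ->
    connect [rel x y | [&& x \in A, y \in A & E x y]] u v.

(* [ucycle] also holds of [:: x; y] when E x y and E y x: going back and forth
   along one edge is not a cycle of the graph, whence the bound 2. *)
Record is_tree (T : finType) (E : rel T) : Prop := IsTree {
  tree_sym : symmetric E;
  tree_irr : irreflexive E;
  tree_nonempty : 0 < #|T|;
  tree_connected : forall x y, connect E x y;
  tree_acyclic : forall c, ucycle E c -> size c <= 2 }.

Record tree_decomposition (V : choiceType) (G : hypergraph V) :=
  TreeDecomposition {
  node : finType;
  tedge : rel node;
  bag : node -> {fset V};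
  guard : node -> {fset {fset V}};
  td_tree : is_tree tedge;
  td_bag_sub : forall v, bag v `<=` hverts G;
  td_guard_sub : forall v, guard v `<=` hedges G;
  td_edge : forall e, e \in hedges G -> exists v, e `<=` bag v;
  td_connected : forall x, x \in hverts G ->
    connected_in tedge [set v | x \in bag v]%SET;
  td_guarded : forall v, bag v `<=` \bigcup_(e <- guard v) e }.

Definition width (V : choiceType) (G : hypergraph V)
    (D : tree_decomposition G) : nat :=
  \max_(v : node D) #|` guard v|.

Definition free_connex (V : choiceType) (G : hypergraph V) (X : {fset V})
    (D : tree_decomposition G) : Prop :=
  exists T' : {set node D},
    [/\ connected_in (@tedge _ _ D) T',
        X = fset0 -> T' = finset.set0 &
        \bigcup_(v in T') bag v = X].

(* Every hypergraph has a decomposition with the single bag \bigcup hedges, so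
   that the minimum in [ghw] exists. *)
Lemma td_exists (V : choiceType) (G : hypergraph V) :
  exists n, `[< exists D : tree_decomposition G, width D = n >].
Proof.
pose B := \bigcup_(e <- hedges G) e.
have tree1 : is_tree [rel x y : unit | false].
  split=> //; first by rewrite card_unit.
    by move=> [] []; exact: connect0.
  move=> c /andP[_ /card_uniqP <-].
  by apply: leq_trans (max_card _) _; rewrite card_unit.
have subB : B `<=` hverts G.
  by apply/bigfcupsP => e eG _; apply: hedges_sub.
have edgeB e : e \in hedges G -> exists v : unit, e `<=` B.
  by move=> eG; exists tt; apply: (@bigfcup_sup _ _ _ e).
have connB x : x \in hverts G ->
    connected_in [rel x y : unit | false] [set v : unit | x \in B]%SET.
  by move=> _ [] [] _ _; exact: connect0.
pose D := @TreeDecomposition V G unit _ (fun=> B) (fun=> hedges G) tree1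
  (fun=> subB) (fun=> fsubset_refl _) edgeB connB (fun=> fsubset_refl _).
by exists (width D); apply/asboolP; exists D.
Qed.

Definition ghw (V : choiceType) (G : hypergraph V) : nat := ex_minn (td_exists G).

Lemma cq_hedges_sub (S : vocabulary) (q : cq S) (e : {fset var S}) :
  e \in [fset avars al | al in atoms q] -> e `<=` vars (atoms q).
Proof. by move=> /imfsetP[al /= qal ->]; apply: (@bigfcup_sup _ _ _ al). Qed.

Definition cq_hypergraph (S : vocabulary) (q : cq S) : hypergraph (var S) :=
  Hypergraph (@cq_hedges_sub S q).

Definition cq_ghw (S : vocabulary) (q : cq S) : nat := ghw (cq_hypergraph q).

(* Witness: two adjacent nodes, with bags [free q] and [vars (atoms q)]. *)
Lemma fctd_exists (S : vocabulary) (q : cq S) :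
  exists n, `[< exists D : tree_decomposition (cq_hypergraph q),
                  free_connex (free q) D /\ width D = n >].
Proof.
pose G := cq_hypergraph q; pose E := [rel x y : bool | x != y].
pose b (v : bool) := if v then free q else vars (atoms q).
have conn2 (x y : bool) : connect E x y.
  by have [->|xy] := eqVneq x y; [exact: connect0 | exact: connect1].
have tree2 : is_tree E.
  split=> //; [by move=> x y; rewrite /= eq_sym | by move=> x; rewrite /= eqxx
    | by rewrite card_bool |].
  move=> c /andP[_ /card_uniqP <-].
  by apply: leq_trans (max_card _) _; rewrite card_bool.
have subb v : b v `<=` hverts G by case: v => /=; rewrite ?free_vars.
have edgeb e : e \in hedges G -> exists v, e `<=` b v.
  by move=> eG; exists false; apply: (@hedges_sub _ G).
have connb x : x \in hverts G -> connected_in E [set v | x \in b v]%SET.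
  move=> _ u v uA vA; have [->|uv] := eqVneq u v; first exact: connect0.
  by apply: connect1; rewrite /= uA vA.
have varsE : vars (atoms q) `<=` \bigcup_(e <- hedges G) e.
  apply/bigfcupsP => al qal _; apply: (@bigfcup_sup _ _ _ (avars al)) => //=.
  by apply/imfsetP; exists al.
have guardb v : b v `<=` \bigcup_(e <- hedges G) e.
  exact: fsubset_trans (subb v) varsE.
pose D := @TreeDecomposition _ G bool E b (fun=> hedges G) tree2
  subb (fun=> fsubset_refl _) edgeb connb guardb.
exists (width D); apply/asboolP; exists D; split=> //.
have [X0|/eqP X0] := eqVneq (free q) fset0.
  exists finset.set0; split=> //; first by move=> u v; rewrite inE.
  by rewrite big1 ?X0 // => i; rewrite inE.
exists [set true]%SET; split=> //; last by rewrite big_set1.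
by move=> u v /set1P-> /set1P->; exact: connect0.
Qed.

Definition cq_fghw (S : vocabulary) (q : cq S) : nat := ex_minn (fctd_exists q).

(* The sequence x_1, al_1, x_2, ..., al_(m-1), x_m is encoded as x_1 together
   with p = [:: (al_1, x_2); ...; (al_(m-1), x_m)]. *)
Fixpoint alternating (S : vocabulary) (q : {fset atom S}) (x : var S)
    (p : seq (atom S * var S)) : bool :=
  if p is (al, y) :: p' then
    [&& al \in q, x \in avars al, y \in avars al & alternating q y p']
  else true.

Definition frontier_path (S : vocabulary) (q : cq S) (x x' : var S)
    (p : seq (atom S * var S)) : Prop :=
  [/\ x != x', alternating (atoms q) x p, last x (unzip2 p) = x' &
      free q `&` [fset y in x :: unzip2 p] = [fset x; x']].

Definition contract_edges (S : vocabulary) (q : cq S) : {fset {fset var S}} :=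
  [fset e in fpowerset (free q) |
     `[< (exists2 al, al \in atoms q & e = avars al `&` free q)
         \/ (exists x x' p, frontier_path q x x' p /\ e = [fset x; x']) >]].

Lemma contract_edges_sub (S : vocabulary) (q : cq S) (e : {fset var S}) :
  e \in contract_edges q -> e `<=` free q.
Proof. by rewrite !inE /= => /andP[]; rewrite fpowersetE. Qed.

Definition contract (S : vocabulary) (q : cq S) : hypergraph (var S) :=
  Hypergraph (@contract_edges_sub S q).

Definition bounded_on (A : Type) (w : A -> nat) (C : set A) : Prop :=
  exists k, forall x, C x -> w x <= k.

(* Main.v *)
(* A graph is a tree iff it is connected and each edge is the only edge across
   some cut; hence subtrees of a tree are closed under intersection and have the
   Helly property, and a set of vertices pairwise sharing bags lies in one bag.

   From a free-connex decomposition of q(X) with subtree T', emptying the bags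
   outside T' and intersecting the guards with X decomposes contract(q(X)): for
   a frontier-path from x to x', the bags meeting its non-free variables form
   with those of x a subtree, and Helly's property puts x and x' in a common bag
   of T'.

   Conversely, the neighbourhood N in X of a component of q - X is a clique of
   contract(q(X)), hence lies in one bag of a decomposition of width l of it.
   Hang from that bag a copy of a decomposition of q of width k, restricted to
   the component and with N added to each bag. An edge of contract(q(X)) being
   covered by two atoms, this is free-connex of width at most k + 2 l. *)
Require Import Defs.
From mathcomp Require Import all_boot finmap.
From mathcomp Require Import boolp classical_sets.

Set Implicit Arguments.
Unset Strict Implicit.
Unset Printing Implicit Defensive.

Local Open Scope fset_scope.

(** * Trees characterised by cuts *)

Definition is_cut (T : finType) (E : rel T) (S : {set T}) (u v : T) : Prop :=
  [/\ u \in S, v \notin S &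
      forall a b, a \in S -> b \notin S -> E a b -> a = u /\ b = v].

Lemma connect_homo (T T' : finType) (e : rel T) (e' : rel T') (f : T -> T')
    (x y : T) :
  {homo f : a b / e a b >-> e' a b} -> connect e x y -> connect e' (f x) (f y).
Proof.
move=> fe /connectP[p ep ->]; apply/connectP; exists (map f p).
  exact: homo_path ep.
by rewrite last_map.
Qed.

Lemma connect_cross (T : finType) (e : rel T) (S : {set T}) (a b : T) :
  connect e a b -> a \in S -> b \notin S ->
  exists c d, [/\ c \in S, d \notin S & e c d].
Proof.
move=> /connectP[p]; elim: p a => [|c p IHp] a /=; first by move=> _ -> ->.
move=> /andP[ac cp] bE aS bS; have [cS|cS] := boolP (c \in S).
  exact: IHp cp bE cS bS.
by exists a, c.
Qed.

Lemma is_cutC (T : finType) (E : rel T) (S : {set T}) (u v : T) :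
  symmetric E -> is_cut E S u v -> is_cut E (~: S)%SET v u.
Proof.
move=> sE [uS vS cS]; split; rewrite ?finset.in_setC ?negbK // => a b.
by rewrite !finset.in_setC negbK => aS bS; rewrite sE => /cS[].
Qed.

(** A walk can enter [S] from outside only by stepping onto [u]. *)
Lemma cut_last (T : finType) (E : rel T) (S : {set T}) (u v w : T) p :
  symmetric E -> is_cut E S u v -> path E w p -> u \notin w :: p ->
  w \notin S -> last w p \notin S.
Proof.
move=> sE [_ _ cS]; elim: p w => [|w' p IHp] w //= /andP[ww' w'p].
rewrite inE negb_or => /andP[_ uw'p] wS; apply: IHp => //.
apply/negP => w'S; rewrite sE in ww'; have [w'u _] := cS _ _ w'S wS ww'.
by rewrite w'u mem_head in uw'p.
Qed.

Lemma tree_cut (T : finType) (E : rel T) (u v : T) :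
  is_tree E -> E u v -> exists S, is_cut E S u v.
Proof.
(* Only the arc from [u] to [v] is deleted; the cut is the set that [u] still reaches. *)
move=> tE uv; pose E' := [rel a b | E a b && ~~ ((a == u) && (b == v))].
exists [set w | connect E' u w]%SET; split; rewrite ?inE ?connect0 //.
  apply/negP => /connectP[p0 pE' vE].
  case/shortenP: pE' vE => p pE' up _ vE.
  have pE : path E u p by apply: sub_path pE' => a b /andP[].
  (* The edge from [v] back to [u] closes the path to a cycle. The bound 2 leaves the empty path,
     excluded by irreflexivity, and the deleted arc itself. *)
  have : size (u :: p) <= 2.
    apply: (tree_acyclic tE); rewrite /ucycle up andbT /= rcons_path pE /=.
    by rewrite -vE (tree_sym tE).
  case: p pE' vE {up pE} => [_ vE|w [|//]] /=.
    by rewrite vE (tree_irr tE) in uv.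
  by rewrite andbT => /andP[_ /negP +] vE; rewrite -vE !eqxx.
move=> a b; rewrite !inE => ua ub ab.
have [/andP[/eqP-> /eqP->] //|abuv] := boolP ((a == u) && (b == v)).
case/negP: ub; apply: connect_trans ua (connect1 _).
by rewrite /= ab abuv.
Qed.

(** On a cycle x, y, z, ... the walk from y to the last vertex avoids x, so it stays beyond the cut
    of the edge x y. The closing edge crosses that cut too, which makes the last vertex y again. *)
Lemma cut_is_tree (T : finType) (E : rel T) :
  symmetric E -> irreflexive E -> 0 < #|T| -> (forall x y, connect E x y) ->
  (forall u v, E u v -> exists S, is_cut E S u v) -> is_tree E.
Proof.
move=> sE iE T0 cE cutE; split=> // -[|x [|y [|z s]]] //.
rewrite /ucycle /= rcons_path => /andP[/and3P[xy yz /andP[zs sx]] /and3P[xN yN _]].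
have [S cutS] := cutE _ _ xy; have [xS yS cS] := cutS.
have lS : last y (z :: s) \notin S.
  by apply: cut_last cutS _ _ yS; rewrite //= yz.
rewrite sE in sx; have [_ ly] := cS _ _ xS lS sx.
by move: yN; rewrite -{1}ly /= mem_last.
Qed.

(** * Subtrees and the Helly property *)

Lemma connected_in_cross (T : finType) (E : rel T) (A S : {set T}) u v a b :
  connected_in E A -> is_cut E S u v -> a \in A -> b \in A ->
  a \in S -> b \notin S -> u \in A /\ v \in A.
Proof.
move=> cA [uS vS cS] aA bA aS bS.
have [c [d [cS' dS /and3P[cA' dA cd]]]] := connect_cross (cA a b aA bA) aS bS.
by have [<- <-] := cS _ _ cS' dS cd.
Qed.

(** The cut at the first edge separates the two ends of the path, so a connected [A] holding both
    contains that edge; induction does the rest. *)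
Lemma tree_path_in (T : finType) (E : rel T) (A : {set T}) u p :
  is_tree E -> connected_in E A -> path E u p -> uniq (u :: p) ->
  u \in A -> last u p \in A -> {subset p <= A}.
Proof.
move=> tE cA; elim: p u => [|w p IHp] u //= /andP[uw wp] /andP[uN wU] uA lA.
have [S cutS] := tree_cut tE uw; have [uS wS _] := cutS.
have lS : last w p \notin S by apply: cut_last cutS _ _ wS => //; case: tE.
have [_ wA] := connected_in_cross cA cutS uA lA uS lS.
by move=> z /predU1P[-> //|]; apply: IHp wA lA z.
Qed.

Lemma connected_inI (T : finType) (E : rel T) (A B : {set T}) :
  is_tree E -> connected_in E A -> connected_in E B ->
  connected_in E (A :&: B)%SET.
Proof.
move=> tE cA cB u v /finset.setIP[uA uB] /finset.setIP[vA vB].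
have [p0 p0E vE] := connectP (cA u v uA vA).
case/shortenP: p0E vE => p pE up _ vE.
have pE' : path E u p by apply: sub_path pE => a b /and3P[].
have lA : last u p \in A by rewrite -vE.
have lB : last u p \in B by rewrite -vE.
have pA := tree_path_in tE cA pE' up uA lA.
have pB := tree_path_in tE cB pE' up uB lB.
apply/connectP; exists p => //.
have upAB : all [in (A :&: B)%SET] (u :: p).
  apply/allP => z /predU1P[->|zp]; rewrite !inE ?uA //=.
  by apply/andP; split; [apply: pA|apply: pB].
elim: p u pE' upAB {p0 uA uB pE up vE lA lB pA pB} => //= w p IHp u.
by move=> /andP[-> wp] /and3P[-> wAB pAB]; rewrite wAB IHp //= wAB.
Qed.

Lemma connected_inS (T : finType) (E : rel T) (A B : {set T}) u v :
  A \subset B -> connected_in E A -> u \in A -> v \in A ->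
  connect [rel x y | [&& x \in B, y \in B & E x y]] u v.
Proof.
move=> /fintype.subsetP AB cA uA vA; apply: connect_sub (cA u v uA vA).
by move=> a b /and3P[aA bA ab]; apply: connect1; rewrite /= !AB.
Qed.

Lemma connected_inU (T : finType) (E : rel T) (A B : {set T}) w :
  connected_in E A -> connected_in E B -> w \in A -> w \in B ->
  connected_in E (A :|: B)%SET.
Proof.
move=> cA cB wA wB u v uAB vAB; apply: (@connect_trans _ _ w).
  by case/finset.setUP: uAB => uX; [apply: (connected_inS _ cA)|apply: (connected_inS _ cB)];
     rewrite ?finset.subsetUl ?finset.subsetUr.
by case/finset.setUP: vAB => uX; [apply: (connected_inS _ cA)|apply: (connected_inS _ cB)];
     rewrite ?finset.subsetUl ?finset.subsetUr.
Qed.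

(** Unless [q] is a common point, a path from [p] to [q] in the subtree [B :&: (A :|: C)] leaves [A]
    by an edge from [w] to [w'], with [w] in [A] and [B], and [w'] in [B] and [C]. If [r] is on the
    side of [w] in the cut at this edge, then [C] crosses it and holds [w]; otherwise [A] would hold
    [w']. *)
Lemma helly3 (T : finType) (E : rel T) (A B C : {set T}) p q r :
  is_tree E -> connected_in E A -> connected_in E B -> connected_in E C ->
  p \in A -> p \in B -> q \in B -> q \in C -> r \in A -> r \in C ->
  exists z, [/\ z \in A, z \in B & z \in C].
Proof.
move=> tE cA cB cC pA pB qB qC rA rC.
have [//|nz] := pselect (exists z, [/\ z \in A, z \in B & z \in C]).
have cBAC := connected_inI tE cB (connected_inU cA cC rA rC).
have pP : p \in (B :&: (A :|: C))%SET by rewrite !inE pA pB.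
have qP : q \in (B :&: (A :|: C))%SET by rewrite !inE qC qB orbT.
have qA : q \notin A by apply/negP => qA; apply: nz; exists q.
have [w [w' [wA w'A /and3P[]]]] := connect_cross (cBAC p q pP qP) pA qA.
rewrite !inE => /andP[wB _]; rewrite (negbTE w'A) => /andP[w'B /= w'C] ww'.
have [S cutS] := tree_cut tE ww'; have [wS w'S _] := cutS.
have [rS|rS] := boolP (r \in S).
  by have [wC _] := connected_in_cross cC cutS rC w'C rS w'S; exists w.
have [_] := connected_in_cross cA cutS wA rA wS rS.
by rewrite (negbTE w'A).
Qed.

(** Induction on the number of sets: the intersections of [A] with the others are again subtrees,
    and they meet pairwise by the case of three sets. *)
Lemma helly (T : finType) (E : rel T) (F : seq {set T}) :
  is_tree E -> (forall A, A \in F -> connected_in E A) ->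
  (forall A B, A \in F -> B \in F -> exists z, z \in (A :&: B)%SET) ->
  exists z, forall A, A \in F -> z \in A.
Proof.
move=> tE; have [n] := ubnP (size F); elim: n F => // n IHn [|A F].
  by have /card_gt0P[z _] := tree_nonempty tE; exists z.
rewrite ltnS /= => Fn cF iF.
have cA : connected_in E A by apply: cF; rewrite mem_head.
have [z zP] : exists z, forall B, B \in [seq (A :&: B)%SET | B <- F] -> z \in B.
  apply: IHn; first by rewrite size_map.
    move=> _ /mapP[B BF ->]; apply: connected_inI => //.
    by apply: cF; rewrite inE BF orbT.
  move=> _ _ /mapP[B BF ->] /mapP[C CF ->].
  have BF' : B \in A :: F by rewrite inE BF orbT.
  have CF' : C \in A :: F by rewrite inE CF orbT.
  have [p /finset.setIP[pA pB]] := iF A B (mem_head _ _) BF'.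
  have [q /finset.setIP[qB qC]] := iF B C BF' CF'.
  have [r /finset.setIP[rA rC]] := iF A C (mem_head _ _) CF'.
  have [z [zA zB zC]] := helly3 tE cA (cF _ BF') (cF _ CF') pA pB qB qC rA rC.
  by exists z; rewrite !inE zA zB zC.
(* For the family [[:: A]] the induction hypothesis says nothing about [z], so a point of [A] is
   taken instead. *)
case: F cF iF zP {Fn} => [|B F] cF iF zP.
  have [w /finset.setIP[wA _]] := iF A A (mem_head _ _) (mem_head _ _).
  by exists w => B; rewrite inE => /eqP->.
exists z => C; rewrite inE => /predU1P[->|CF].
  by have /finset.setIP[] : z \in (A :&: B)%SET by apply: zP; rewrite mem_head.
by have /finset.setIP[] : z \in (A :&: C)%SET by apply: zP; apply: map_f.
Qed.

Lemma clique_bag (V : choiceType) (T : finType) (E : rel T) (b : T -> {fset V})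
    (K : {fset V}) :
  is_tree E ->
  (forall x, x \in K -> connected_in E [set v | x \in b v]%SET) ->
  (forall x y, x \in K -> y \in K -> exists v, x \in b v /\ y \in b v) ->
  exists v, K `<=` b v.
Proof.
move=> tE cb Kb.
have [||v vP] := @helly T E [seq [set v | x \in b v]%SET | x <- enum_fset K] tE.
- by move=> _ /mapP[x xK ->]; apply: cb.
- move=> _ _ /mapP[x xK ->] /mapP[y yK ->].
  by have [v [xv yv]] := Kb x y xK yK; exists v; rewrite !inE xv.
exists v; apply/fsubsetP => x xK.
suff : v \in [set v | x \in b v]%SET by rewrite inE.
by apply: vP; apply: map_f.
Qed.

(** * Minimal widths, and edges of the contraction *)

Lemma ghw_le (V : choiceType) (G : hypergraph V) (D : tree_decomposition G) :
  ghw G <= width D.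
Proof. by rewrite /ghw; case: ex_minnP => n _; apply; apply/asboolP; exists D. Qed.

Lemma ghw_witness (V : choiceType) (G : hypergraph V) :
  exists D : tree_decomposition G, width D = ghw G.
Proof. by rewrite /ghw; case: ex_minnP => n /asboolP[D <-] _; exists D. Qed.

Lemma cq_fghw_le (S : vocabulary) (q : cq S)
    (D : tree_decomposition (cq_hypergraph q)) :
  free_connex (free q) D -> cq_fghw q <= width D.
Proof.
by move=> fD; rewrite /cq_fghw; case: ex_minnP => n _; apply; apply/asboolP; exists D.
Qed.

Lemma cq_fghw_witness (S : vocabulary) (q : cq S) :
  exists2 D : tree_decomposition (cq_hypergraph q),
    free_connex (free q) D & width D = cq_fghw q.
Proof.
by rewrite /cq_fghw; case: ex_minnP => n /asboolP[D [fD <-]] _; exists D.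
Qed.

Lemma contract_edge_atom (S : vocabulary) (q : cq S) (al : atom S) :
  al \in atoms q -> avars al `&` free q \in contract_edges q.
Proof.
move=> qal; rewrite !inE /= fpowersetE fsubsetIr /=.
by apply/asboolP; left; exists al.
Qed.

Lemma contract_edge_path (S : vocabulary) (q : cq S) x x' p :
  frontier_path q x x' p -> [fset x; x'] \in contract_edges q.
Proof.
move=> xx'; rewrite !inE /= fpowersetE; apply/andP; split.
  by case: xx' => _ _ _ <-; apply: fsubsetIl.
by apply/asboolP; right; exists x, x', p.
Qed.

Lemma contract_edgeP (S : vocabulary) (q : cq S) e :
  e \in contract_edges q ->
  (exists2 al, al \in atoms q & e = avars al `&` free q) \/
  (exists x x' p, frontier_path q x x' p /\ e = [fset x; x']).
Proof. by rewrite !inE /= => /andP[_ /asboolP]. Qed.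

Lemma avars_vars (S : vocabulary) (q : {fset atom S}) al x :
  al \in q -> x \in avars al -> x \in vars q.
Proof. by move=> qal xal; apply/bigfcupP; exists al; rewrite ?qal. Qed.

Lemma varsP (S : vocabulary) (q : {fset atom S}) x :
  x \in vars q -> exists2 al, al \in q & x \in avars al.
Proof. by move=> /bigfcupP[al]; rewrite andbT => qal xal; exists al. Qed.

Lemma free_in_vars (S : vocabulary) (q : cq S) x :
  x \in free q -> x \in vars (atoms q).
Proof. exact/fsubsetP/free_vars. Qed.

Lemma avars_bag (S : vocabulary) (q : cq S)
    (D : tree_decomposition (cq_hypergraph q)) al :
  al \in atoms q -> exists v : node D, avars al `<=` bag v.
Proof. by move=> qal; apply: td_edge; apply/imfsetP; exists al. Qed.

(** * From a free-connex decomposition to one of the contraction *)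

(** Helly's property for [T'], the nodes holding [x'], and the nodes holding [x] enlarged by [B].
    The common node lies in [T'], hence not in [B], so its bag holds [x]. *)
Lemma frontier_end (S : vocabulary) (q : cq S)
    (D : tree_decomposition (cq_hypergraph q)) (T' B : {set node D}) x x' :
  connected_in (@tedge _ _ D) T' -> \bigcup_(v in T') bag v = free q ->
  x \in free q -> x' \in free q ->
  connected_in (@tedge _ _ D) ([set v | x \in bag v] :|: B)%SET ->
  (forall v, v \in B -> v \notin T') ->
  (exists2 v, v \in ([set v | x \in bag v] :|: B)%SET & x' \in bag v) ->
  exists v, [/\ v \in T', x \in bag v & x' \in bag v].
Proof.
move=> cT TX xX x'X cB BT [r rB r'].
have freeT z : z \in free q -> exists2 v, v \in T' & z \in bag v.
  by rewrite -TX => /bigfcupP[v /andP[_ vT] zv]; exists v.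
have [t tT xt] := freeT _ xX; have [s sT xs] := freeT _ x'X.
have cx' : connected_in (@tedge _ _ D) [set v | x' \in bag v]%SET.
  exact/td_connected/free_in_vars.
have [|||z [zB zT zx']] :=
  @helly3 _ _ _ _ _ t s r (td_tree D) cB cT cx' _ tT sT _ rB; rewrite ?inE ?xt ?xs ?r' //.
exists z; split=> //; last by rewrite inE in zx'.
move: zB; rewrite !inE => /orP[//|/BT]; by rewrite zT.
Qed.

(* A frontier path may come back to its endpoints, so the free variables met
   are only known to be among x and x'. Otherwise the bags meeting the non-free
   part of the walk form, with those of y, the connected set [A_y :|: B]. *)
Lemma frontier_walk (S : vocabulary) (q : cq S)
    (D : tree_decomposition (cq_hypergraph q)) (T' : {set node D}) x x' p y :
  connected_in (@tedge _ _ D) T' -> \bigcup_(v in T') bag v = free q ->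
  x \in free q -> x' \in free q ->
  alternating (atoms q) y p -> last y (unzip2 p) = x' ->
  (forall z, z \in y :: unzip2 p -> z \in free q -> z = x \/ z = x') ->
  (exists v, [/\ v \in T', x \in bag v & x' \in bag v]) \/
  exists B : {set node D},
    [/\ connected_in (@tedge _ _ D) ([set v | y \in bag v] :|: B)%SET,
        forall v, v \in B -> v \notin T' &
        exists2 v, v \in ([set v | y \in bag v] :|: B)%SET & x' \in bag v].
Proof.
move=> cT TX xX x'X.
have cA z : z \in vars (atoms q) ->
    connected_in (@tedge _ _ D) [set v | z \in bag v]%SET.
  by move=> zq; exact/td_connected.
have TB v z : v \in T' -> z \in bag v -> z \in free q.
  by move=> vT zv; rewrite -TX; apply/bigfcupP; exists v; rewrite ?mem_index_enum.
elim: p y => [|[al z] p IHp] y /=.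
  move=> _ -> _; right; exists finset.set0.
  rewrite finset.setU0; split; first exact/cA/free_in_vars.
    by move=> v; rewrite inE.
  have := x'X; rewrite -{1}TX => /bigfcupP[v _ x'v].
  by exists v; rewrite ?inE.
move=> /and4P[qal yal zal zp] lp freexx'.
have [v alv] := @avars_bag _ _ D _ qal.
have yv := fsubsetP alv _ yal; have zv := fsubsetP alv _ zal.
have cy := cA _ (avars_vars qal yal); have cz := cA _ (avars_vars qal zal).
have {IHp} [|//|[B [cB BT [w wB x'w]]]] := IHp z zp lp.
- by move=> u up; apply: freexx'; rewrite inE up orbT.
- by left.
have [zX|zX] := boolP (z \in free q).
  have [|zx|zx'] := freexx' z _ zX; first by rewrite !inE eqxx orbT.
    left; subst z; apply: frontier_end cT TX xX x'X cB BT _; by exists w.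
  right; exists finset.set0; rewrite finset.setU0; split=> //.
    by move=> u; rewrite inE.
  by exists v; rewrite ?inE // -zx'.
right; exists ([set u | z \in bag u] :|: B)%SET; split.
- by apply: (connected_inU (w := v) cy cB); rewrite !inE ?yv ?zv.
- move=> u /finset.setUP[|/BT //]; rewrite inE => zu.
  by apply: contra zX => uT; apply: TB uT zu.
- by exists w => //; rewrite finset.in_setU wB orbT.
Qed.

Lemma frontier_bag (S : vocabulary) (q : cq S)
    (D : tree_decomposition (cq_hypergraph q)) (T' : {set node D}) x x' p :
  connected_in (@tedge _ _ D) T' -> \bigcup_(v in T') bag v = free q ->
  frontier_path q x x' p ->
  exists v, [/\ v \in T', x \in bag v & x' \in bag v].
Proof.
move=> cT TX [_ altp lp pX].
have pE z : (z \in free q) && (z \in x :: unzip2 p) = (z == x) || (z == x').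
  by move/fsetP/(_ z): pX; rewrite !inE.
have /andP[xX _] : (x \in free q) && (x \in x :: unzip2 p) by rewrite pE eqxx.
have /andP[x'X _] : (x' \in free q) && (x' \in x :: unzip2 p).
  by rewrite pE eqxx orbT.
have [|//|[B [cB BT Bx']]] := @frontier_walk S q D T' x x' p x cT TX xX x'X altp lp.
  by move=> z zp zX; move: (pE z); rewrite zp zX => /esym /orP[/eqP|/eqP]; auto.
exact: frontier_end cB BT Bx'.
Qed.

Lemma ghw_contract_le (S : vocabulary) (q : cq S) :
  ghw (contract q) <= cq_fghw q.
Proof.
have [D [T' [cT _ TX]] <-] := cq_fghw_witness q.
(* Nodes outside [T'] stay in the tree with an empty bag, so the tree itself is unchanged. *)
pose b v := if v \in T' then bag v else fset0.
pose g v := [fset e `&` free q | e in @guard _ _ D v].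
have bE x v : (x \in b v) = (v \in T') && (x \in bag v).
  by rewrite /b; case: ifP.
have b_sub v : b v `<=` hverts (contract q).
  apply/fsubsetP => x; rewrite bE => /andP[vT xv] /=.
  by rewrite -TX; apply/bigfcupP; exists v; rewrite ?mem_index_enum.
have g_sub v : g v `<=` hedges (contract q).
  apply/fsubsetP => _ /imfsetP[e /= eg ->].
  have /imfsetP[al /= qal ->] := fsubsetP (td_guard_sub v) _ eg.
  exact: contract_edge_atom.
have b_conn x : x \in hverts (contract q) ->
    connected_in (@tedge _ _ D) [set v | x \in b v]%SET.
  move=> xX; rewrite (_ : finset _ = T' :&: [set v | x \in bag v])%SET.
    apply: (connected_inI (td_tree D) cT).
    exact/td_connected/free_in_vars.
  by apply/finset.setP => v; rewrite !inE bE.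
have b_edge e : e \in hedges (contract q) -> exists v, e `<=` b v.
  move=> /contract_edgeP[[al qal ->]|[x [x' [p [xx' ->]]]]]; last first.
    have [v [vT xv x'v]] := frontier_bag cT TX xx'.
    by exists v; apply/fsubsetP => z; rewrite !inE bE vT => /orP[]/eqP->.
  (* The bag of [D] covering the atom may lie outside [T']. Any two free variables of the atom share
     a bag in [T'], by [frontier_end] with empty [B], and so all of them do. *)
  apply: (clique_bag (td_tree D)).
    by move=> x /fsetIP[_ xX]; apply: b_conn.
  move=> x x' /fsetIP[xal xX] /fsetIP[x'al x'X].
  have [v alv] := @avars_bag _ _ D _ qal.
  have [|||w [wT xw x'w]] :=
    @frontier_end _ _ D T' finset.set0 x x' cT TX xX x'X.
  - by rewrite finset.setU0; exact/td_connected/free_in_vars.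
  - by move=> u; rewrite inE.
  - by exists v; rewrite ?inE (fsubsetP alv).
  by exists w; rewrite !bE wT.
have b_guard v : b v `<=` \bigcup_(e <- g v) e.
  apply/fsubsetP => x xv; have xX := fsubsetP (b_sub v) _ xv.
  move: xv; rewrite bE => /andP[_ /(fsubsetP (td_guarded v)) /bigfcupP[e]].
  rewrite andbT => eg xe; apply/bigfcupP; exists (e `&` free q).
    by rewrite andbT; apply/imfsetP; exists e.
  by rewrite inE xe.
pose D' := TreeDecomposition (td_tree D) b_sub g_sub b_edge b_conn b_guard.
apply: leq_trans (ghw_le D') _; apply/bigmax_leqP => v _ /=.
by apply: leq_trans (leq_bigmax v); apply: leq_imfset_card.
Qed.

(** * Hanging copies of one tree from another *)

(** The hub [T1] with a copy of [T2] for every [i], whose node [t0] is joined to [n i]. *)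
Definition glue (I T1 T2 : finType) (E1 : rel T1) (E2 : rel T2) (n : I -> T1)
    (t0 : T2) : rel (T1 + I * T2) :=
  fun x y => match x, y with
  | inl a, inl b => E1 a b
  | inr (i, s), inr (j, t) => (i == j) && E2 s t
  | inl a, inr (i, t) | inr (i, t), inl a => (a == n i) && (t == t0)
  end.

Lemma glue_sym (I T1 T2 : finType) (E1 : rel T1) (E2 : rel T2) (n : I -> T1) t0 :
  symmetric E1 -> symmetric E2 -> symmetric (glue E1 E2 n t0).
Proof. by move=> s1 s2 [a|[i s]] [b|[j t]] //=; rewrite eq_sym s2. Qed.

(** Every point reaches the hub inside the set, through its copy and the attaching edge. Sets of
    this form are the nodes holding a free variable, the subtree for free-connexity and the whole
    tree. *)
Lemma glue_connected (I T1 T2 : finType) (E1 : rel T1) (E2 : rel T2)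
    (n : I -> T1) (t0 : T2) (A : {set T1}) (J : pred I) :
  is_tree E1 -> is_tree E2 -> connected_in E1 A ->
  (forall i, J i -> n i \in A) ->
  connected_in (glue E1 E2 n t0)
    [set x | match x with inl a => a \in A | inr (i, _) => J i end]%SET.
Proof.
move=> t1 t2 cA JA; set B := finset _.
set e := [rel x y | [&& x \in B, y \in B & glue E1 E2 n t0 x y]].
have se : symmetric e.
  move=> x y /=; rewrite (glue_sym _ _ (tree_sym t1) (tree_sym t2)).
  by rewrite andbA [(x \in _) && _]andbC andbA.
have hub x : x \in B -> exists2 a, a \in A & connect e x (inl a).
  case: x => [a|[i t]]; rewrite inE => xB; first by exists a.
  exists (n i); first exact: JA.
  apply: (@connect_trans _ _ (inr (i, t0))); last first.
    by apply: connect1; rewrite /= !inE JA ?xB ?eqxx.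
  apply: (connect_homo (f := fun t => inr (i, t)) _ (tree_connected t2 t t0)).
  by move=> s s' ss' /=; rewrite !inE xB eqxx.
move=> x y xB yB; have [a aA xa] := hub x xB; have [b bA yb] := hub y yB.
apply: connect_trans xa _; rewrite (sym_connect_sym se).
apply: connect_trans yb _.
apply: (connect_homo (f := inl) _ (cA b a bA aA)) => c d /=.
by rewrite !inE.
Qed.

(** Serves the non-free variables, each of which will occur in one copy only. *)
Lemma glue_copy_connected (I T1 T2 : finType) (E1 : rel T1) (E2 : rel T2)
    (n : I -> T1) (t0 : T2) (i : I) (A : {set T2}) :
  connected_in E2 A ->
  connected_in (glue E1 E2 n t0) [set inr (i, t) | t in A]%SET.
Proof.
move=> cA _ _ /imsetP[s sA ->] /imsetP[t tA ->].
apply: (connect_homo (f := fun t => inr (i, t)) _ (cA s t sA tA)) => a b /=.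
by move=> /and3P[aA bA ab]; rewrite !imset_f //= eqxx.
Qed.

Lemma glue_is_tree (I T1 T2 : finType) (E1 : rel T1) (E2 : rel T2)
    (n : I -> T1) (t0 : T2) :
  is_tree E1 -> is_tree E2 -> is_tree (glue E1 E2 n t0).
Proof.
move=> t1 t2; have sG := glue_sym n t0 (tree_sym t1) (tree_sym t2).
(* The attaching edge of copy [i] is cut by separating that copy from everything else. *)
have cut_hub i : exists S, is_cut (glue E1 E2 n t0) S (inl (n i)) (inr (i, t0)).
  exists [set x | if x is inr (j, _) then j != i else true]%SET.
  split; rewrite ?inE ?eqxx // => -[a|[j s]] [b|[k t]]; rewrite !inE //=.
    by move=> _ /negPn/eqP-> /andP[/eqP-> /eqP->].
  by move=> /negbTE ji /negPn/eqP-> /andP[]; rewrite ji.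
apply: cut_is_tree => //.
- by move=> [a|[i s]] /=; rewrite ?(tree_irr t1) ?(tree_irr t2) ?andbF.
- by have /card_gt0P[a _] := tree_nonempty t1; apply/card_gt0P; exists (inl a).
- move=> x y.
  have cT : connected_in E1 finset.setT.
    move=> a b _ _; apply: connect_sub (tree_connected t1 a b) => c d cd.
    by apply: connect1; rewrite /= !inE.
  have := @glue_connected I _ _ _ _ n t0 _ predT t1 t2 cT.
  move=> /(_ (fun _ _ => finset.in_setT _)) /(_ x y).
  have inT (z : T1 + I * T2) : z \in
      [set x | match x with inl a => a \in finset.setT | inr (i, _) => predT i end]%SET.
    by case: z => [a|[i t]]; rewrite !inE.
  move=> /(_ (inT x) (inT y)); apply: connect_sub => u v /and3P[_ _].
  exact: connect1.
move=> [a|[i s]] [b|[j t]] /=.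
- move=> ab; have [S [aS bS cS]] := tree_cut t1 ab.
  (* A cut of the hub extends by putting each copy on the side of its attaching node. *)
  exists [set x | match x with inl c => c \in S | inr (i, _) => n i \in S end]%SET.
  split; rewrite ?inE // => -[c|[k s]] [d|[l t]]; rewrite !inE /=.
  + by move=> cS' dS cd; have [-> ->] := cS _ _ cS' dS cd.
  + by move=> cS' lS /andP[/eqP cl _]; rewrite cl (negbTE lS) in cS'.
  + by move=> kS dS /andP[/eqP dk _]; rewrite dk kS in dS.
  + by move=> kS lS /andP[/eqP kl _]; rewrite kl (negbTE lS) in kS.
- by move=> /andP[/eqP-> /eqP->].
- move=> /andP[/eqP-> /eqP->]; have [S cS] := cut_hub i.
  by exists (~: S)%SET; apply: is_cutC.
move=> /andP[/eqP<- st]; have [S [sS tS cS]] := tree_cut t2 st.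
(* A cut inside copy [i] extends by putting everything else on the side of [t0]. *)
exists [set x | if x is inr (k, u) then (if k == i then u \in S else t0 \in S)
                else t0 \in S]%SET.
split; rewrite ?inE ?eqxx // => -[c|[k u]] [d|[l v]]; rewrite !inE /=.
- by move=> ->.
- by move=> t0S + /andP[_ /eqP vt]; rewrite vt t0S if_same.
- by move=> + t0S /andP[_ /eqP ut]; rewrite ut (negbTE t0S) if_same.
- move=> + + /andP[/eqP kl uv]; rewrite -kl; case: eqP => [->|_ -> //].
  by move=> uS vS; have [-> ->] := cS _ _ uS vS uv.
Qed.

(** * Components of the non-free variables and their boundaries *)

Lemma alternating_rcons (S : vocabulary) (q : {fset atom S}) y p al x :
  alternating q y p -> al \in q -> last y (unzip2 p) \in avars al ->
  x \in avars al -> alternating q y (rcons p (al, x)).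
Proof.
elim: p y => [|[al' z] p IHp] y /=; first by move=> _ -> -> ->.
by move=> /and4P[-> -> -> zp] /(IHp z zp) + lal xal => ->.
Qed.

(* Adjacency of the non-free variables; its classes [root (nonfree_adj q) y]
   are the connected components of q once the free variables are removed. *)
Definition nonfree_adj (S : vocabulary) (q : cq S) : rel (vars (atoms q)) :=
  fun z z' => [&& val z \notin free q, val z' \notin free q &
    has (fun al => (val z \in avars al) && (val z' \in avars al)) (atoms q)].

Arguments nonfree_adj {S} q.

(** Indexing by all variables avoids a quotient: the set is empty unless [y] is the representative
    of a class of non-free variables. *)
Definition component (S : vocabulary) (q : cq S) (y : vars (atoms q)) :
    {fset var S} :=
  [fset x in vars (atoms q) | [exists z : vars (atoms q),
     [&& val z == x, x \notin free q & root (nonfree_adj q) z == y]]].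

Definition boundary (S : vocabulary) (q : cq S) (y : vars (atoms q)) :
    {fset var S} :=
  [fset x in free q | [exists z : vars (atoms q),
     [&& val z \notin free q, root (nonfree_adj q) z == y &
      has (fun al => (x \in avars al) && (val z \in avars al)) (atoms q)]]].

Arguments component {S} q y.
Arguments boundary {S} q y.

Lemma nonfree_adj_sym (S : vocabulary) (q : cq S) :
  connect_sym (nonfree_adj q).
Proof.
apply: sym_connect_sym => z z'; rewrite /nonfree_adj andbCA; congr [&& _, _ & _].
by apply: eq_has => al; rewrite andbC.
Qed.

Lemma componentP (S : vocabulary) (q : cq S) y x : x \in component q y ->
  exists z : vars (atoms q),
    [/\ val z = x, x \notin free q & root (nonfree_adj q) z = y].
Proof.
by rewrite !inE /= => /andP[_ /existsP[z /and3P[/eqP zx xX /eqP zy]]]; exists z.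
Qed.

Lemma mem_component (S : vocabulary) (q : cq S) (z : vars (atoms q)) :
  val z \notin free q -> val z \in component q (root (nonfree_adj q) z).
Proof.
move=> zX; rewrite !inE /= (valP z) /=; apply/existsP; exists z.
by rewrite !eqxx zX.
Qed.

Lemma boundaryP (S : vocabulary) (q : cq S) y x : x \in boundary q y ->
  x \in free q /\ exists (z : vars (atoms q)) al,
    [/\ val z \notin free q, root (nonfree_adj q) z = y, al \in atoms q,
        x \in avars al & val z \in avars al].
Proof.
rewrite !inE /= => /andP[xX /existsP[z /and3P[zX /eqP zy /hasP[al qal]]]].
by move=> /andP[xal zal]; split=> //; exists z, al.
Qed.

Lemma mem_boundary (S : vocabulary) (q : cq S) (z : vars (atoms q)) al x :
  x \in free q -> val z \notin free q -> al \in atoms q -> x \in avars al ->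
  val z \in avars al -> x \in boundary q (root (nonfree_adj q) z).
Proof.
move=> xX zX qal xal zal; rewrite !inE /= xX; apply/existsP; exists z.
by rewrite zX eqxx /=; apply/hasP; exists al => //; rewrite xal.
Qed.

Lemma nonfree_walk (S : vocabulary) (q : cq S) (z z' : vars (atoms q)) :
  connect (nonfree_adj q) z z' ->
  exists p, [/\ alternating (atoms q) (val z) p, last (val z) (unzip2 p) = val z' &
                forall w, w \in unzip2 p -> w \notin free q].
Proof.
move=> /connectP[r]; elim: r z => [|u r IHr] z /=; first by move=> _ ->; exists [::].
move=> /andP[/and3P[zX uX /hasP[al qal /andP[zal ual]]] ur] z'E.
have [p [up lp pX]] := IHr u ur z'E; exists ((al, val u) :: p).
split=> //=; first by apply/and4P.
by move=> w; rewrite inE => /predU1P[->|/pX].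
Qed.

(** A walk from [x] into the component, through it and out to [x'] has only non-free inner
    variables, so it is a frontier path. *)
Lemma boundary_clique (S : vocabulary) (q : cq S) (y : vars (atoms q)) x x' :
  x \in boundary q y -> x' \in boundary q y ->
  exists e, [/\ e \in contract_edges q, x \in e & x' \in e].
Proof.
move=> /boundaryP[xX [z [al [zX zy qal xal zal]]]].
move=> /boundaryP[x'X [z' [al' [z'X z'y qal' x'al' z'al']]]].
(* A frontier path has distinct ends, so for a single variable the edge of an atom is used. *)
have [<-|xx'] := eqVneq x x'.
  by exists (avars al `&` free q); rewrite contract_edge_atom // in_fsetI xal xX.
have zz' : connect (nonfree_adj q) z z'.
  by rewrite -(root_connect (@nonfree_adj_sym S q)) zy z'y.
have [p [zp lp pX]] := nonfree_walk zz'.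
exists [fset x; x']; rewrite !in_fset2 !eqxx orbT; split=> //.
apply: (@contract_edge_path S q x x' ((al, val z) :: rcons p (al', x'))); split=> //=.
- by apply/and4P; split=> //; apply: alternating_rcons; rewrite ?lp.
- by rewrite /unzip2 map_rcons last_rcons.
apply/fsetP => w; rewrite !inE /= /unzip2 map_rcons mem_rcons inE.
have [->|wx] := eqVneq w x; first by rewrite xX.
have [->|wx'] := eqVneq w x'; first by rewrite x'X ?orbT.
have [wX|//] := boolP (w \in free q); rewrite /=; apply/negP => /orP[/eqP wz|wp].
  by case/negP: zX; move: wX; rewrite wz.
by have := pX _ wp; rewrite wX.
Qed.

(** * Bounding the free-connex width *)

(** An edge from an atom lies in that atom; one from a frontier path has two ends, each in some
    atom. Membership of [e] is asked only in the last clause, so that [choice] gives a function on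
    all sets with the bound 2 throughout. *)
Lemma contract_edge_cover (S : vocabulary) (q : cq S) e :
  exists F : {fset {fset var S}},
    [/\ F `<=` hedges (cq_hypergraph q), #|` F| <= 2 &
        e \in contract_edges q -> e `<=` \bigcup_(f <- F) f].
Proof.
have [eE|_] := boolP (e \in contract_edges q); last first.
  by exists fset0; rewrite fsub0set cardfs0.
have edge al : al \in atoms q -> avars al \in hedges (cq_hypergraph q).
  by move=> qal; apply/imfsetP; exists al.
case/contract_edgeP: (eE) => [[al qal ->]|[x [x' [p [xx' eq_e]]]]].
  exists [fset avars al]; rewrite fsub1set edge // cardfs1 big_seq_fset1.
  by rewrite fsubsetIl.
have varE z : z \in e -> exists2 al, al \in atoms q & z \in avars al.
  by move=> ze; apply/varsP/free_in_vars; apply: (fsubsetP (contract_edges_sub eE)).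
have [|al qal xal] := varE x; first by rewrite eq_e !inE eqxx.
have [|al' qal' xal'] := varE x'; first by rewrite eq_e !inE eqxx orbT.
exists [fset avars al; avars al']; split.
- by apply/fsubsetP => f; rewrite !inE => /orP[]/eqP->; apply: edge.
- by rewrite cardfs2; case: eqP.
move=> _; apply/fsubsetP => z; rewrite eq_e !inE => /orP[]/eqP->; apply/bigfcupP.
  by exists (avars al); rewrite // !inE eqxx.
by exists (avars al'); rewrite // !inE eqxx orbT.
Qed.

Lemma card_bigfcup_le (I : Type) (K : choiceType) (r : seq I)
    (F : I -> {fset K}) k :
  (forall i, #|` F i| <= k) -> #|` \bigcup_(i <- r) F i| <= k * size r.
Proof.
move=> Fk; elim: r => [|i r IHr]; first by rewrite big_nil cardfs0.
rewrite big_cons mulnS; apply: leq_trans (leq_card_fsetU _ _) _.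
exact: leq_add.
Qed.

Lemma cq_fghw_ub (S : vocabulary) (q : cq S) :
  cq_fghw q <= cq_ghw q + 2 * ghw (contract q).
Proof.
rewrite /cq_ghw; have [D1 <-] := ghw_witness (cq_hypergraph q).
have [D2 <-] := ghw_witness (contract q).
have [cov covP] := choice (@contract_edge_cover S q).
(* Any node of [D1] can serve to attach its copies. *)
have [t0 _] := card_gt0P (tree_nonempty (td_tree D1)).
have nP (y : vars (atoms q)) : exists v : node D2, boundary q y `<=` bag v.
  apply: (clique_bag (td_tree D2)) => [x /boundaryP[xX _]|x x' xy x'y].
    exact: td_connected.
  have [e [eE xe x'e]] := boundary_clique xy x'y.
  by have [v /fsubsetP ev] := td_edge D2 eE; exists v; split; apply: ev.
have [n nB] := choice nP.
pose E := glue (@tedge _ _ D2) (@tedge _ _ D1) n t0.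
pose g2 (v : node D2) := \bigcup_(e <- guard v) cov e.
(* The boundary goes into every bag of a copy, so that a free variable fills whole copies, each
   attached at a hub node [n y] that holds it. *)
pose b (w : node D2 + vars (atoms q) * node D1) := match w with
  | inl v => bag v
  | inr (y, t) => (bag t `&` component q y) `|` boundary q y
  end.
(* In a copy, [guard t] covers the part in the component and the guards of the hub node [n y] cover
   the boundary, whence the sum in the bound. *)
pose g (w : node D2 + vars (atoms q) * node D1) := match w with
  | inl v => g2 v
  | inr (y, t) => guard t `|` g2 (n y)
  end.
have bd_sub (y : vars (atoms q)) : boundary q y `<=` free q.
  by apply/fsubsetP => x /boundaryP[xX _].
have g2P v : bag v `<=` \bigcup_(f <- g2 v) f.
  apply/fsubsetP => x /(fsubsetP (td_guarded v)) /bigfcupP[e].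
  rewrite andbT => ev xe; have [_ _ /(_ _)] := covP e.
  move=> /(_ (fsubsetP (td_guard_sub v) _ ev)) /fsubsetP/(_ _ xe).
  move=> /bigfcupP[f]; rewrite andbT => fe xf; apply/bigfcupP; exists f => //.
  by rewrite andbT; apply/bigfcupP; exists e; rewrite ?ev.
have g2_sub v : g2 v `<=` hedges (cq_hypergraph q).
  by apply/bigfcupsP => e _ _; have [] := covP e.
have b_sub w : b w `<=` hverts (cq_hypergraph q).
  case: w => [v|[y t]] /=; first exact: fsubset_trans (td_bag_sub v) (free_vars q).
  rewrite fsubUset (fsubset_trans (bd_sub y) (free_vars q)) andbT.
  exact: fsubset_trans (fsubsetIl _ _) (td_bag_sub t).
have g_sub w : g w `<=` hedges (cq_hypergraph q).
  by case: w => [v|[y t]] //=; rewrite fsubUset g2_sub td_guard_sub.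
have b_edge e : e \in hedges (cq_hypergraph q) -> exists w, e `<=` b w.
  move=> /imfsetP[al /= qal ->].
  (* An atom with only free variables is an edge of the contraction and fits in the hub. Otherwise
     its non-free variables lie in one component, and its free ones in the boundary of that
     component. *)
  have [/fsetIidPl alX|/fsubsetPn[z zal zX]] := boolP (avars al `<=` free q).
    have [v ev] := td_edge D2 (contract_edge_atom qal).
    by exists (inl v); rewrite alX in ev.
  pose z' : vars (atoms q) := [` avars_vars qal zal].
  have [t alt] := avars_bag D1 qal.
  exists (inr (root (nonfree_adj q) z', t)) => /=; apply/fsubsetP => x xal.
  rewrite in_fsetU; have [xX|xX] := boolP (x \in free q).
    by rewrite (@mem_boundary _ _ z' al) ?orbT.
  rewrite in_fsetI (fsubsetP alt) //=; pose x' : vars (atoms q) := [` avars_vars qal xal].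
  suff <- : root (nonfree_adj q) x' = root (nonfree_adj q) z'.
    by rewrite (@mem_component _ _ x').
  apply/eqP; rewrite root_connect; last exact: nonfree_adj_sym.
  by apply: connect1; rewrite /nonfree_adj xX zX; apply/hasP; exists al => //; apply/andP.
have b_conn x : x \in hverts (cq_hypergraph q) ->
    connected_in E [set w | x \in b w]%SET.
  move=> xq; have [xX|xX] := boolP (x \in free q).
    rewrite (_ : finset _ = [set w | match w with
      | inl v => v \in [set v | x \in bag v]%SET | inr (y, _) => x \in boundary q y end]%SET).
      apply: (@glue_connected _ _ _ _ _ n t0 _ (fun y => x \in boundary q y)
        (td_tree D2) (td_tree D1)).
        exact: td_connected.
      by move=> y xy; rewrite inE (fsubsetP (nB y)).
    apply/finset.setP => -[v|[y t]]; rewrite !finset.in_set //= in_fsetU in_fsetI.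
    by case: (boolP (x \in component q y)) => [/componentP[z [_]]|_]; rewrite ?xX ?andbF.
  (* Hub bags and boundaries hold only free variables, so a non-free one occurs just in the copy for
     its own component. *)
  pose x' : vars (atoms q) := [` xq]; pose y := root (nonfree_adj q) x'.
  rewrite (_ : finset _ = [set inr (y, t) | t in [set t | x \in bag t]%SET]%SET).
    exact/glue_copy_connected/td_connected.
  apply/finset.setP => w; rewrite inE; apply/idP/imsetP; last first.
    move=> [t]; rewrite inE => xt -> /=.
    by rewrite !in_fsetU in_fsetI xt (@mem_component _ _ x').
  case: w => [v|[y' t]] /=.
    by move=> /(fsubsetP (td_bag_sub v)) xX'; case/negP: xX.
  rewrite in_fsetU in_fsetI => /orP[/andP[xt /componentP[z [zx _ zy']]]|].
    exists t; rewrite ?inE // -zy'; congr (inr (root _ _, _)).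
    exact: val_inj.
  by move=> /(fsubsetP (bd_sub _)); rewrite (negbTE xX).
have b_guard w : b w `<=` \bigcup_(e <- g w) e.
  case: w => [v|[y t]] /=; first exact: g2P.
  rewrite fsubUset; apply/andP; split.
    apply: fsubset_trans (fsubsetIl _ _) _; apply: fsubset_trans (td_guarded t) _.
    apply/bigfcupsP => e et _; apply: (@bigfcup_sup _ _ _ e) => //.
    by rewrite in_fsetU et.
  apply: fsubset_trans (nB y) _; apply: fsubset_trans (g2P _) _.
  apply/bigfcupsP => e et _; apply: (@bigfcup_sup _ _ _ e) => //.
  by rewrite in_fsetU et orbT.
pose D := TreeDecomposition (glue_is_tree n t0 (td_tree D2) (td_tree D1))
  b_sub g_sub b_edge b_conn b_guard.
have g2_card v : #|` g2 v| <= 2 * width D2.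
  apply: (@leq_trans (2 * #|` guard v|)).
    by apply: card_bigfcup_le => e; have [] := covP e.
  by rewrite leq_mul2l (leq_bigmax (F := fun v => #|` guard v|)).
apply: (@leq_trans (width D)).
  apply: cq_fghw_le.
  have [X0|/eqP X0] := eqVneq (free q) fset0.
    exists finset.set0; split=> //; first by move=> u v; rewrite inE.
    by rewrite big1 ?X0 // => i; rewrite inE.
  (* The subtree is the whole hub. Its bags exhaust [free q], because every free variable lies in
     some atom, whose free part is an edge of the contraction. *)
  exists [set w | match w with inl v => v \in finset.setT | inr (y, _) => pred0 y end]%SET.
  split=> //.
    apply: (@glue_connected _ _ _ _ _ n t0 _ pred0 (td_tree D2) (td_tree D1)) => // u v _ _.
    apply: connect_sub (tree_connected (td_tree D2) u v) => c d cd.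
    by apply: connect1; rewrite /= !inE.
  apply/fsetP => x; apply/bigfcupP/idP.
    by move=> [[v|[y t]]]; rewrite !inE ?andbF //= => _ /(fsubsetP (td_bag_sub v)).
  move=> xX; have [al qal xal] := varsP (free_in_vars xX).
  have [v ev] := td_edge D2 (contract_edge_atom qal).
  exists (inl v); first by rewrite mem_index_enum !inE.
  by rewrite /= (fsubsetP ev) // in_fsetI xal.
apply/bigmax_leqP => -[v|[y t]] _ /=.
  by apply: leq_trans (g2_card v) (leq_addl _ _).
apply: leq_trans (leq_card_fsetU _ _) _; apply: leq_add => //.
exact: (leq_bigmax (F := fun v => #|` guard v|)).
Qed.

Theorem lemma7p1 (S : vocabulary) (C : set (cq S)) :
  bounded_on (@cq_fghw S) C <->
  bounded_on (@cq_ghw S) C /\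
  bounded_on (@ghw (var S)) (@contract S @` C)%classic.
Proof.
split=> [[k Ck]|[[k Ck] [l Cl]]].
  split; exists k; last first.
    by move=> _ [q /Ck qk <-]; apply: leq_trans (ghw_contract_le q) qk.
  move=> q /Ck; apply: leq_trans.
  by have [D _ <-] := cq_fghw_witness q; apply: ghw_le.
exists (k + 2 * l)%N => q Cq; apply: leq_trans (cq_fghw_ub q) _.
by rewrite leq_add ?leq_mul2l ?Ck //= Cl //; exists q.
Qed.
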